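(* Let $n\ge 2$ and let $G\subseteq \mathbf{U}(n,\mathbb{C})$ be a unipotent linear algebraic group such that the monoid $M:=G_{\mathbb{N}}$ is finitely generated. If $S$ is a unipotent numerical monoid in $M$, then $S$ is finitely generated. Furthermore, $S$ possesses a unique minimal set of generators.
   Context: $\mathbb{N}=\{0,1,2,\dots\}$. $\mathbf{U}(n,\mathbb{C})$ is the group of upper triangular $n\times n$ complex matrices with all diagonal entries equal to $1$. A unipotent linear algebraic group $G$ is taken to be a Zariski-closed subgroup of $\mathbf{U}(n,\mathbb{C})$ which is defined over $\mathbb{Q}$ (its defining equations have rational coefficients). $G_{\mathbb{N}}$ denotes the set of elements of $G$ all of whose entries lie in $\mathbb{N}$; it is a monoid under matrix multiplication. A submonoid $S$ of a monoid $M$ is complement-finite if $M\setminus S$ is a finite set. For $M=G_{\mathbb{N}}$ finitely generated, a unipotent numerical monoid in $M$ is a complement-finite submonoid $S$ of $M$. A set of generators of $S$ is a subset $P\subseteq S$ such that every element of $S$ is a (possibly empty) product of elements of $P$; minimal means minimal with respect to inclusion among sets of generators. *)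

(* Defs.v *)
From HB Require Import structures.
From mathcomp Require Import all_boot all_order all_algebra.
From mathcomp Require Export complex.
From mathcomp Require Export boolp classical_sets functions cardinality reals.
From mathcomp Require Export mpoly.

Set Implicit Arguments.
Unset Strict Implicit.
Unset Printing Implicit Defensive.

Import GRing.Theory.
Local Open Scope ring_scope.
Local Open Scope classical_set_scope.

Definition unitriangular (R : realType) (n : nat) : set 'M[R[i]]_n :=
  [set A : 'M[R[i]]_n |
           (forall i j : 'I_n, (j < i)%N -> A i j = 0) /\
           (forall i : 'I_n, A i i = 1)].
Arguments unitriangular : clear implicits.

(* The n * n variables of the polynomials in Q stand for the matrix entries,
   enumerated by [mxvec]. An arbitrary family Q is allowed: by Hilbert's basis
   theorem finitely many equations would give the same zero loci. *)
Definition rational_zero_locus (R : realType) (n : nat)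
    (Q : set {mpoly rat[n * n]}) : set 'M[R[i]]_n :=
  [set A : 'M[R[i]]_n | forall p, Q p ->
     (map_mpoly (ratr : rat -> R[i]) p).@[mxvec A 0] = 0].
Arguments rational_zero_locus R [n] Q _.

Definition matrix_subgroup (R : realType) (n : nat) (G : set 'M[R[i]]_n) :=
  [/\ G 1%:M,
      forall A B, G A -> G B -> G (A *m B) &
      forall A, G A -> A \in unitmx /\ G (invmx A)].

Definition unipotent_algebraic_group (R : realType) (n : nat)
    (G : set 'M[R[i]]_n) :=
  matrix_subgroup G /\
  exists Q : set {mpoly rat[n * n]},
    G = unitriangular R n `&` rational_zero_locus R Q.

Definition nat_points (R : realType) (n : nat) (G : set 'M[R[i]]_n) :
    set 'M[R[i]]_n :=
  [set A : 'M[R[i]]_n | G A /\ forall i j : 'I_n, exists k : nat, A i j = k%:R].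

Definition submonoid (R : realType) (n : nat) (S M : set 'M[R[i]]_n) :=
  [/\ S `<=` M,
      S 1%:M &
      forall A B, S A -> S B -> S (A *m B)].

Definition complement_finite_submonoid (R : realType) (n : nat)
    (S M : set 'M[R[i]]_n) :=
  submonoid S M /\ finite_set (M `\` S).

Definition generating_set (R : realType) (n : nat) (P S : set 'M[R[i]]_n) :=
  P `<=` S /\
  forall A, S A -> exists s : seq 'M[R[i]]_n,
    (forall B, B \in s -> P B) /\ A = \big[mulmx/1%:M]_(B <- s) B.

Definition finitely_generated (R : realType) (n : nat) (S : set 'M[R[i]]_n) :=
  exists P : set 'M[R[i]]_n, finite_set P /\ generating_set P S.

Definition minimal_generating_set (R : realType) (n : nat)
    (P S : set 'M[R[i]]_n) :=
  generating_set P S /\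
  forall P' : set 'M[R[i]]_n, generating_set P' S -> P' `<=` P -> P' = P.

Definition unipotent_numerical_monoid (R : realType) (n : nat)
    (S M : set 'M[R[i]]_n) :=
  finitely_generated M /\ complement_finite_submonoid S M.

(* Main.v *)
From HB Require Import structures.
Require Import Defs.
From mathcomp Require Import all_boot all_order all_algebra.

(**
Finite generation: write an element of S as a word in the finite generating set
X of M and cut it at the first non-empty prefix lying in S. That prefix is in
F X, where F = (M \ S) + {1}. The remaining suffix is either in S, and one
continues with it, or in M \ S, and then the whole element is in F X F.
So S is generated by the finite set S /\ F X F.

Minimal generators: the sum of the off-diagonal entries is a natural number,
superadditive under products and zero only at 1. Hence every element of S is
a product of atoms of S, while any generating set must contain the atoms.
*)

Set Implicit Arguments.
Unset Strict Implicit.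
Unset Printing Implicit Defensive.

Import GRing.Theory Num.Theory.
Local Open Scope ring_scope.
Local Open Scope classical_set_scope.

(** This makes [big_seq1] and [big_cat] applicable to the products of words. *)
HB.instance Definition _ (R : pzSemiRingType) (n : nat) :=
  Monoid.isLaw.Build 'M[R]_n 1%:M (@mulmx R n n n)
    (@mulmxA R n n n n) (@mul1mx R n n) (@mulmx1 R n n).

Lemma cofinite_submonoid_finitely_generated (R : realType) (n : nat)
    (S M : set 'M[R[i]]_n) :
  submonoid M M -> finitely_generated M -> complement_finite_submonoid S M ->
  finitely_generated S.
Proof.
move=> [_ M1 MM] [X [finX [XM genX]]] [[SM S1 SS] finF].
pose F := (M `\` S) `|` [set 1%:M].
pose Y := S `&` [set p.1.1 *m p.1.2 *m p.2 | p in (F `*` X) `*` F].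
have FM A : F A -> M A by case=> [[]//|->].
have F1 : F 1%:M by right.
have YP A B C : F A -> X B -> F C -> S (A *m B *m C) -> Y (A *m B *m C).
  by move=> FA XB FC SABC; split=> //; exists (A, B, C).
exists Y; split.
  apply: finite_setIr; apply: finite_image.
  have finF1 : finite_set F by rewrite finite_setU; split.
  by apply: finite_setX => //; apply: finite_setX.
split=> [A []//|].
(* Here [A] accumulates the letters read since the last cut, and [s] is what remains to be read. [A]
   stays in [F] until the next cut; each piece starts from [1%:M]. *)
suff word s A : (forall B, B \in s -> X B) -> F A ->
    S (A *m \big[mulmx/1%:M]_(B <- s) B) ->
    exists t, (forall B, B \in t -> Y B) /\
      A *m \big[mulmx/1%:M]_(B <- s) B = \big[mulmx/1%:M]_(B <- t) B.
  move=> A SA; have [s [Xs defA]] := genX A (SM _ SA).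
  by have := word s 1%:M Xs F1; rewrite mul1mx -defA; apply.
elim: s A => [|x s IHs] A Xs FA.
  (* With no letter left, [A] lies in both [S] and [F], which forces [A] to be the identity. *)
  rewrite big_nil mulmx1 => SA; exists [::]; split=> //.
  by rewrite big_nil; case: FA => [[]|].
have Xx : X x by apply: Xs; rewrite mem_head.
have {}Xs B : B \in s -> X B by move=> Bs; apply: Xs; rewrite inE Bs orbT.
have Ms : M (\big[mulmx/1%:M]_(B <- s) B).
  rewrite big_seq; elim/big_ind: _ => // B Bs.
  exact: XM (Xs _ Bs).
rewrite big_cons mulmxA => SAxs.
have [SAx|nSAx] := pselect (S (A *m x)); last first.
  apply: IHs => //; left; split=> //.
  by apply: MM; [exact: FM|exact: XM].
have [Ss|nSs] := pselect (S (\big[mulmx/1%:M]_(B <- s) B)).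
  (* Cut after [x]: the piece [A *m x] lies in [Y] with third factor 1, and reading restarts from
     1. *)
  have [|t [Yt]] := IHs 1%:M Xs F1; rewrite mul1mx // => ->.
  exists (A *m x :: t); rewrite big_cons; split=> // B.
  rewrite inE => /orP[/eqP->|]; last exact: Yt.
  by rewrite -[_ *m x]mulmx1; apply: YP; rewrite ?mulmx1.
(* The remaining suffix lies in [M] outside [S], hence in [F], so the whole product is a single
   generator. *)
exists [:: A *m x *m \big[mulmx/1%:M]_(B <- s) B]; rewrite big_seq1.
by split=> // B; rewrite inE => /eqP->; apply: YP => //; left.
Qed.

Definition atoms (R : realType) (n : nat) (S : set 'M[R[i]]_n) :=
  [set A | [/\ S A, A <> 1%:M & forall B C, S B -> S C -> A = B *m C ->
     B = 1%:M \/ C = 1%:M]].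

(** Split a word for the atom into head and tail: one of them is 1. If it is the head, drop it and
    go on ([P] may contain 1); if it is the tail, the atom is the head. The word cannot run out,
    since an atom is not 1. *)
Lemma atoms_sub_generating_set (R : realType) (n : nat)
    (P S M : set 'M[R[i]]_n) :
  submonoid S M -> generating_set P S -> atoms S `<=` P.
Proof.
move=> [_ S1 SS] [PS genP] A [SA nA1 irrA].
have [s [Ps defA]] := genP A SA.
elim: s Ps defA => [|B s IHs] Ps; first by rewrite big_nil.
have PB : P B by apply: Ps; rewrite mem_head.
have {}Ps C : C \in s -> P C by move=> Cs; apply: Ps; rewrite inE Cs orbT.
have Ss : S (\big[mulmx/1%:M]_(C <- s) C).
  rewrite big_seq; elim/big_ind: _ => // C Cs.
  exact: PS (Ps _ Cs).
rewrite big_cons => defA; have [B1|s1] := irrA _ _ (PS _ PB) Ss defA.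
  by apply: IHs => //; rewrite defA B1 mul1mx.
by rewrite defA s1 mulmx1.
Qed.

Lemma unique_minimal_generating_set (R : realType) (n : nat)
    (S M : set 'M[R[i]]_n) :
  submonoid S M -> generating_set (atoms S) S ->
  exists! P, minimal_generating_set P S.
Proof.
move=> SM genA; exists (atoms S); split.
  split=> // P genP PA; apply/seteqP; split=> //.
  exact: (atoms_sub_generating_set SM genP).
move=> P [genP minP]; apply: minP => //.
exact: (atoms_sub_generating_set SM genP).
Qed.

(* A valuation into nat is given as a relation, so that it need only be defined
   on S. *)
Lemma atoms_generating_set (R : realType) (n : nat) (S M : set 'M[R[i]]_n)
    (w : 'M[R[i]]_n -> nat -> Prop) :
  submonoid S M ->
  (forall A, S A -> exists k, w A k) ->
  (forall A, S A -> w A 0%N -> A = 1%:M) ->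
  (forall A B k a b, S A -> S B -> w (A *m B) k -> w A a -> w B b ->
     (a + b <= k)%N) ->
  generating_set (atoms S) S.
Proof.
move=> [_ S1 SS] w_ex w0 wM; split=> [A []//|A SA].
have [k] := w_ex A SA; elim/ltn_ind: k A SA => k IHk A SA wAk.
have [->|nA1] := pselect (A = 1%:M).
  by exists [::]; rewrite big_nil.
have [atomA|natomA] := pselect (atoms S A).
  by exists [:: A]; rewrite big_seq1; split=> // B; rewrite inE => /eqP->.
have [B [C [SB SC defA nB1 nC1]]] :
    exists B C, [/\ S B, S C, A = B *m C, B <> 1%:M & C <> 1%:M].
  apply: contrapT => noBC; apply: natomA; split=> // B C SB SC defA.
  have [|nB1] := pselect (B = 1%:M); first by left.
  have [|nC1] := pselect (C = 1%:M); first by right.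
  by case: noBC; exists B, C.
have [b wBb] := w_ex B SB; have [c wCc] := w_ex C SC.
have lebck : (b + c <= k)%N by apply: wM wBb wCc; rewrite -?defA.
(* Only 1 can have value 0, so both proper factors have positive values, and superadditivity makes
   each value smaller than [k]. *)
have b_gt0 : (0 < b)%N.
  by rewrite lt0n; apply/eqP => b0; apply: nB1; apply: w0; rewrite // -b0.
have c_gt0 : (0 < c)%N.
  by rewrite lt0n; apply/eqP => c0; apply: nC1; apply: w0; rewrite // -c0.
have ltbk : (b < k)%N.
  by apply: leq_trans lebck; rewrite -addn1 leq_add2l.
have ltck : (c < k)%N.
  by apply: leq_trans lebck; rewrite -add1n leq_add2r.
have [s [atom_s defB]] := IHk b ltbk B SB wBb.
have [t [atom_t defC]] := IHk c ltck C SC wCc.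
exists (s ++ t); rewrite big_cat defA defB defC; split=> // D.
by rewrite mem_cat => /orP[/atom_s|/atom_t].
Qed.

(** A single function [N] carries all the natural entries, so that sums and products can be computed
    in [nat]. *)
Definition nat_entries (R : realType) (m n : nat) (A : 'M[R[i]]_(m, n)) :=
  exists N : 'I_m -> 'I_n -> nat, A = \matrix_(i, j) (N i j)%:R.

Lemma nat_entriesP (R : realType) (m n : nat) (A : 'M[R[i]]_(m, n)) :
  (forall i j, exists k : nat, A i j = k%:R) -> nat_entries A.
Proof.
move=> natA; exists (fun i j => projT1 (cid (natA i j))).
by apply/matrixP => i j; rewrite mxE; case: cid.
Qed.

Lemma nat_entriesM (R : realType) (m n p : nat) (A : 'M[R[i]]_(m, n))
    (B : 'M[R[i]]_(n, p)) :
  nat_entries A -> nat_entries B -> nat_entries (A *m B).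
Proof.
move=> [N ->] [K ->]; exists (fun i k => (\sum_j N i j * K j k)%N).
apply/matrixP => i k; rewrite !mxE natr_sum.
by apply: eq_bigr => j _; rewrite !mxE natrM.
Qed.

Lemma nat_entries_sum (R : realType) (m n : nat) (A : 'M[R[i]]_(m, n)) :
  nat_entries A -> exists k : nat, \sum_i \sum_j A i j = k%:R.
Proof.
move=> [N ->]; exists (\sum_i \sum_j N i j)%N.
rewrite natr_sum; apply: eq_bigr => i _; rewrite natr_sum.
by apply: eq_bigr => j _; rewrite mxE.
Qed.

Lemma nat_entries_sum0 (R : realType) (m n : nat) (A : 'M[R[i]]_(m, n)) :
  nat_entries A -> \sum_i \sum_j A i j = 0 -> A = 0.
Proof.
move=> [N ->] /eqP.
have natrN_ge0 i j : 0 <= (\matrix_(i, j) (N i j)%:R : 'M[R[i]]_(m, n)) i j.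
  by rewrite mxE ler0n.
rewrite psumr_eq0 => [|i _]; last exact: sumr_ge0.
move=> /allP rows0; apply/matrixP => i j; rewrite [RHS]mxE.
have := rows0 i (mem_index_enum i); rewrite /= psumr_eq0 // => /allP row0.
exact/eqP/(row0 j (mem_index_enum j)).
Qed.

Lemma nat_points_sub1 (R : realType) (n : nat) (G : set 'M[R[i]]_n) A :
  G `<=` unitriangular R n -> nat_points G A -> nat_entries (A - 1%:M).
Proof.
move=> GU [/GU[_ diagA] natA]; apply: nat_entriesP => i j; rewrite !mxE.
have [<-|_] := eqVneq i j; first by exists 0%N; rewrite diagA subrr.
by have [k ->] := natA i j; exists k; rewrite subr0.
Qed.

Lemma nat_points_submonoid (R : realType) (n : nat) (G : set 'M[R[i]]_n) :
  matrix_subgroup G -> submonoid (nat_points G) (nat_points G).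
Proof.
move=> [G1 GM _]; split=> //.
  by split=> // i j; exists (i == j); rewrite mxE.
move=> A B [GA natA] [GB natB]; split; first exact: GM.
have [N ->] := nat_entriesM (nat_entriesP natA) (nat_entriesP natB).
by move=> i j; exists (N i j); rewrite mxE.
Qed.

Lemma nat_points_atoms_generating_set (R : realType) (n : nat)
    (G S : set 'M[R[i]]_n) :
  G `<=` unitriangular R n -> submonoid S (nat_points G) ->
  generating_set (atoms S) S.
Proof.
move=> GU subS; have [SM _ _] := subS.
(* Since the diagonal of [A] is 1, this is the sum of the off-diagonal entries. *)
pose w A (k : nat) := \sum_i \sum_j (A - 1%:M : 'M[R[i]]_n) i j = k%:R.
have natS A : S A -> nat_entries (A - 1%:M).
  by move=> /SM; exact: nat_points_sub1.
apply: (atoms_generating_set (w := w) subS) => [A SA|A SA wA|].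
- exact: nat_entries_sum (natS A SA).
- by apply/eqP; rewrite -subr_eq0; apply/eqP/nat_entries_sum0 => //; apply: natS.
move=> A B k a b SA SB.
(* Superadditivity comes from AB - 1 = (A - 1)(B - 1) + (A - 1) + (B - 1), whose first term has
   natural entries; their sum [c] is the excess of [k] over [a + b]. *)
have -> : w (A *m B) k = (\sum_i \sum_j ((A - 1%:M) *m (B - 1%:M)
    + (A - 1%:M + (B - 1%:M))) i j = k%:R).
  rewrite /w mulmxBl mulmxBr mul1mx mulmx1; congr (_ = _).
  apply: eq_bigr => i _; apply: eq_bigr => j _; congr (fun_of_matrix _ i j).
  by rewrite [A - _ + _]addrC addrA subrK addrA subrK.
have [c defc] := nat_entries_sum (nat_entriesM (natS A SA) (natS B SB)).
move=> wAB wA wB; suff -> : k = (c + (a + b))%N by rewrite leq_addl.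
(* Naturals embed injectively in the complex numbers, so the equality is checked there. *)
apply/eqP; rewrite -(eqr_nat R[i]) -wAB !natrD -defc -wA -wB -!big_split.
apply/eqP/eq_bigr => i _; rewrite -!big_split.
by apply: eq_bigr => j _ /=; rewrite mxE [X in _ + X]mxE.
Qed.

Theorem theorem1p4 (R : realType) (n : nat) (hn : (2 <= n)%N)
    (G : set 'M[R[i]]_n) (hG : unipotent_algebraic_group G)
    (hM : finitely_generated (nat_points G))
    (S : set 'M[R[i]]_n)
    (hS : unipotent_numerical_monoid S (nat_points G)) :
  finitely_generated S /\
  exists! P : set 'M[R[i]]_n, minimal_generating_set P S.
Proof.
have [subG [Q defG]] := hG; have [_ cofS] := hS; have [subS _] := cofS.
split.
  apply: cofinite_submonoid_finitely_generated cofS => //.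
  exact: nat_points_submonoid.
apply: (unique_minimal_generating_set subS).
by apply: nat_points_atoms_generating_set subS; rewrite defG => A [].
Qed.
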